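(* Let $\mathbb{F}$ be a field with $\mathrm{char}\,\mathbb{F} \neq 2$, and let $k \leq n$ and $n \geq 3$ be integers. Then a linear subspace $W \leq M_n(\mathbb{F})$ satisfies $\rho_{\mathbf{1}}(W)=k$ and $\dim W=kn$ if and only if $W=\mathrm{span}\{e_i\}_{i \in I} \otimes \mathbb{F}^n$ or $W=\mathbb{F}^n \otimes \mathrm{span}\{e_i\}_{i \in I}$ for some $k$-element subset $I \subset [n]$.
   Context: $[n]=\{1,\dots,n\}$, $M_n(\mathbb{F})$ is the space of $n\times n$ matrices over $\mathbb{F}$, and $e_i$ is the $i$-th unit column vector in $\mathbb{F}^n$. For column vectors $u,v\in\mathbb{F}^n$, $u\otimes v=u v^t\in M_n(\mathbb{F})$, and for subspaces $U_1,U_2\le\mathbb{F}^n$, $U_1\otimes U_2=\mathrm{span}\{u_1\otimes u_2:u_1\in U_1,u_2\in U_2\}$. For $A\in M_n(\mathbb{F})$ and $k$-element subsets $I=\{i_1<\dots<i_k\}$, $J=\{j_1<\dots<j_k\}$ of $[n]$, $A[I|J]$ is the submatrix with $(\alpha,\beta)$ entry $A(i_\alpha,j_\beta)$. The permanent of $B\in M_k(\mathbb{F})$ is $\mathrm{per}\,B=\sum_{\sigma\in\mathbb{S}_k}\prod_{i=1}^k B(i,\sigma(i))$; the permanental rank of $A$ is the largest $k$ with $\mathrm{per}\,A[I|J]\neq0$ for some $k$-element $I,J$; and $\rho_{\mathbf{1}}(W)$ is the maximum permanental rank of a matrix in $W$. *)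

(* Defs.v *)
From HB Require Import structures.
From mathcomp Require Import all_boot all_order all_algebra all_fingroup.

Set Implicit Arguments.
Unset Strict Implicit.
Unset Printing Implicit Defensive.

Import GRing.Theory.
Local Open Scope ring_scope.

Definition permanent (R : comNzRingType) (k : nat) (B : 'M[R]_k) : R :=
  \sum_(s : 'S_k) \prod_i B i (s i).

Definition ksubset (n k : nat) := {I : {set 'I_n} | #|I| == k}.

(* [enum] lists a set of ordinals in increasing order, so [ksubset_elt I] is
   the increasing enumeration i_1 < ... < i_k of I; see [ksubset_elt_mono]. *)
Definition ksubset_elt (n k : nat) (I : ksubset n k) (a : 'I_k) : 'I_n :=
  enum_val (cast_ord (esym (eqP (valP I))) a).

Lemma ksubset_elt_mem (n k : nat) (I : ksubset n k) (a : 'I_k) :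
  ksubset_elt I a \in val I.
Proof. exact: enum_valP. Qed.

Lemma ksubset_elt_mono (n k : nat) (I : ksubset n k) (a b : 'I_k) :
  (a < b)%N -> (ksubset_elt I a < ksubset_elt I b)%N.
Proof.
move=> ltab; rewrite /ksubset_elt.
set a' := cast_ord _ a; set b' := cast_ord _ b.
have x0 : 'I_n := enum_val a'.
rewrite !(enum_val_nth x0).
have srt : sorted (fun i j : 'I_n => (i < j)%N) (enum (val I)).
  rewrite /enum_mem.
  apply: sorted_filter; first by move=> ? ? ?; apply: ltn_trans.
  by have := iota_ltn_sorted 0 n; rewrite -val_enum_ord sorted_map enumT.
apply: (sorted_ltn_nth _ x0 srt) => //.
- by move=> ? ? ?; apply: ltn_trans.
- by rewrite inE -cardE ltn_ord.
- by rewrite inE -cardE ltn_ord.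
Qed.

Definition minormx (R : Type) (n k : nat) (A : 'M[R]_n) (I J : ksubset n k) :
    'M[R]_k :=
  mxsub (ksubset_elt I) (ksubset_elt J) A.

Definition has_permanental_minor (R : comNzRingType) (n k : nat)
    (A : 'M[R]_n) : bool :=
  [exists I : ksubset n k, exists J : ksubset n k,
     permanent (minormx A I J) != 0].

Definition permanental_rank (R : comNzRingType) (n : nat) (A : 'M[R]_n) : nat :=
  \max_(k < n.+1 | has_permanental_minor k A) k.

Lemma permanental_rank_max (R : comNzRingType) (n : nat) (A : 'M[R]_n) :
  has_permanental_minor (permanental_rank A) A /\
  forall k, has_permanental_minor k A -> (k <= permanental_rank A)%N.
Proof.
split.
  have h0 : has_permanental_minor (@ord0 n) A.
    have c0 : #|@set0 'I_n| == 0%N by rewrite cards0.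
    pose I0 : ksubset n 0 := exist _ set0 c0.
    apply/existsP; exists I0; apply/existsP; exists I0.
    rewrite /permanent; under eq_bigr do rewrite big_ord0.
    by rewrite sumr_const card_Sn oner_neq0.
  rewrite /permanental_rank (bigop.bigmax_eq_arg ord0) //.
  by case: arg_maxnP.
move=> k hk.
have lekn : (k < n.+1)%N.
  case/existsP: hk => I _; rewrite ltnS -(eqP (valP I)).
  by rewrite -[leqRHS]card_ord max_card.
exact: (leq_bigmax_cond (F := @nat_of_ord n.+1) (Ordinal lekn) hk).
Qed.

(* [rho1 W k] states that the maximum of the permanental rank over W is k. *)
Definition rho1 (F : fieldType) (n : nat) (W : {vspace 'M[F]_n}) (k : nat) :
    Prop :=
  (exists2 A, A \in W & permanental_rank A = k) /\
  (forall A, A \in W -> (permanental_rank A <= k)%N).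

Definition tensor (F : fieldType) (n : nat) (u v : 'cV[F]_n) : 'M[F]_n :=
  u *m v^T.

(* As for the library's product of spaces [prodv], the span of all u (x) v is
   computed from bases; see [tensorv_spanP]. *)
Definition tensorv (F : fieldType) (n : nat) (U1 U2 : {vspace 'cV[F]_n}) :
    {vspace 'M[F]_n} :=
  <<[seq tensor u v | u <- vbasis U1, v <- vbasis U2]>>%VS.

Lemma memv_tensor (F : fieldType) (n : nat) (U1 U2 : {vspace 'cV[F]_n})
    (u v : 'cV[F]_n) :
  u \in U1 -> v \in U2 -> tensor u v \in tensorv U1 U2.
Proof.
move=> /coord_vbasis -> /coord_vbasis ->.
rewrite /tensor mulmx_suml memv_suml // => i _.
rewrite linear_sum /= mulmx_sumr memv_suml // => j _.
rewrite linearZ /= -scalemxAl -scalemxAr !memvZ // memv_span //.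
by apply/allpairsP; exists ((vbasis U1)`_i, (vbasis U2)`_j);
  rewrite /= !mem_nth ?size_tuple.
Qed.

Lemma tensorv_spanP (F : fieldType) (n : nat) (U1 U2 : {vspace 'cV[F]_n})
    (M : 'M[F]_n) :
  M \in tensorv U1 U2 <->
  exists2 s : seq 'M[F]_n,
    (forall A, A \in s ->
       exists u v, [/\ u \in U1, v \in U2 & A = tensor u v]) &
    M \in <<s>>%VS.
Proof.
split=> [MT | [s sP]]; last first.
  apply/subvP/span_subvP => A /sP [u [v [uU vU ->]]]; exact: memv_tensor.
exists [seq tensor u v | u <- vbasis U1, v <- vbasis U2] => // A.
case/allpairsP=> -[u v] /= [uU vU ->].
by exists u, v; rewrite !vbasis_mem.
Qed.

Definition coord_space (F : fieldType) (n : nat) (I : {set 'I_n}) :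
    {vspace 'cV[F]_n} :=
  <<[seq delta_mx i ord0 | i in I]>>%VS.

(* Main.v *)
Require Import Defs.
From HB Require Import structures.
From mathcomp Require Import all_boot all_order all_algebra all_fingroup.

Set Implicit Arguments.
Unset Strict Implicit.
Unset Printing Implicit Defensive.

Import GRing.Theory.
Local Open Scope ring_scope.

(* The lexicographically leading cells of the elements of W (its pivots) number
   at least dim W.  A matching of m pivots makes some mixed permanent of m
   elements of W nonzero, and by polarization some m x m permanental minor is
   nonzero on W; hence every permutation meets the pivots in at most k cells.
   The n cyclic shifts of a permutation tile the n x n square, so when
   dim W = kn every permutation meets the pivots in exactly k cells, which
   forces them to fill k full rows or k full columns.  W then has a basis dual
   to these cells, and the vanishing of the mixed permanents on k + 1 rows
   kills all other entries of the basis element of the cell (i, j): outside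
   column j because n >= 3 leaves a third column, and in column j because
   x + y = y + z = x + z = 0 implies x = 0 in characteristic other than 2. *)

(** * Permanents of submatrices and the permanental rank *)

Lemma permanent_trmx (R : comNzRingType) (m : nat) (A : 'M[R]_m) :
  permanent A^T = permanent A.
Proof.
rewrite /permanent [RHS](reindex_inj invg_inj) /=; apply: eq_bigr => s _.
rewrite [RHS](reindex_inj (@perm_inj _ s)) /=; apply: eq_bigr => i _.
by rewrite mxE permK.
Qed.

Lemma permanent_mxsub_perm (R : comNzRingType) (m n : nat) (A : 'M[R]_n)
    (f g : 'I_m -> 'I_n) (s t : 'S_m) :
  permanent (mxsub (f \o s) (g \o t) A) = permanent (mxsub f g A).
Proof.
rewrite /permanent.
(* Replacing [u] by [s * u * t^-1] cancels [t]; the remaining [s] only reorders the factors. *)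
rewrite (reindex_inj (can_inj (mulgK t^-1%g))) (reindex_inj (can_inj (mulKg s))).
apply: eq_bigr => u _.
rewrite [RHS](reindex_inj (@perm_inj _ s)) /=; apply: eq_bigr => i _.
by rewrite !mxE /= !permM permKV.
Qed.

(** Links arbitrary injective index maps to sorted subsets: [I] is the image of [f], and [s] records
    the rank of each value in it. *)
Lemma injective_ksubset_elt (m n : nat) (f : 'I_m -> 'I_n) : injective f ->
  exists I : ksubset n m, exists s : 'S_m, f =1 ksubset_elt I \o s.
Proof.
move=> f_inj.
have cI : #|f @: setT| == m by rewrite card_imset // cardsT card_ord.
pose I : ksubset n m := exist _ (f @: setT) cI.
have fI i : f i \in val I by apply/imsetP; exists i; rewrite ?inE.
pose h i := cast_ord (eqP (valP I)) (enum_rank_in (fI i) (f i)).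
have hE i : ksubset_elt I (h i) = f i.
  by rewrite /ksubset_elt /h cast_ordK enum_rankK_in.
have h_inj : injective h by move=> i j /(congr1 (ksubset_elt I)); rewrite !hE => /f_inj.
by exists I, (perm h_inj) => i; rewrite /= permE hE.
Qed.

Lemma permanental_rank_permanent0 (R : comNzRingType) (m n : nat) (A : 'M[R]_n)
    (f g : 'I_m -> 'I_n) : injective f -> injective g ->
  (permanental_rank A < m)%N -> permanent (mxsub f g A) = 0.
Proof.
move=> /injective_ksubset_elt [I [s fE]] /injective_ksubset_elt [J [t gE]] ltAm.
rewrite (@eq_mxsub _ _ _ _ _ _ _ _ _ fE gE) permanent_mxsub_perm; apply/eqP/negPn/negP => per_n0.
have /(proj2 (permanental_rank_max A)) : has_permanental_minor m A.
  by apply/existsP; exists I; apply/existsP; exists J.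
by rewrite leqNgt ltAm.
Qed.

Lemma permanental_rank_trmx (R : comNzRingType) (n : nat) (A : 'M[R]_n) :
  permanental_rank A^T = permanental_rank A.
Proof.
apply: eq_bigl => k; apply/existsP/existsP => -[I /existsP [J per_n0]];
  exists J; apply/existsP; exists I; move: per_n0;
  by rewrite /minormx -permanent_trmx -trmx_mxsub ?trmxK.
Qed.

(** * Mixed permanents *)

(** The coefficient of $x_1 \cdots x_m$ in the permanent of $\sum_t x_t B_t$; the permutation [t]
    says which matrix supplies each row. *)
Definition mixed_permanent (R : comNzRingType) (m : nat) (B : 'I_m -> 'M[R]_m) : R :=
  \sum_(s : 'S_m) \sum_(t : 'S_m) \prod_i B (t i) i (s i).

(** Inclusion-exclusion: the sum factors over [t]. A value hit by [h] forces [e t] to be true and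
    contributes -1; a missed value contributes 1 - 1 = 0, and a non-injective [h] misses one. *)
Lemma signed_subset_sum (R : comNzRingType) (m : nat) (h : {ffun 'I_m -> 'I_m}) :
  \sum_(e : {ffun 'I_m -> bool})
     (\prod_t (-1) ^+ e t) * \prod_i (e (h i))%:R =
  (if injectiveb h then (-1) ^+ m else 0) :> R.
Proof.
pose G t (b : bool) : R := (-1) ^+ b * \prod_(i | h i == t) b%:R.
transitivity (\prod_t \sum_b G t b).
  rewrite bigA_distr_bigA; apply: eq_bigr => e _; rewrite big_split /=; congr (_ * _).
  rewrite (partition_big h predT) //=; apply: eq_bigr => t _.
  by apply: eq_bigr => i /eqP ->.
have GE t : \sum_b G t b = if t \in codom h then -1 else 0.
  rewrite big_bool /G big1 // mulr1 expr1 expr0 mul1r.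
  case: ifPn => [/codomP [i ->] | tNh].
    by rewrite (bigD1 i) //= mul0r addr0.
  rewrite big_pred0 => [|i]; first exact: addNr.
  apply/eqP => hi; case/negP: tNh.
  by rewrite -hi codom_f.
under eq_bigr do rewrite GE.
case: ifPn => [/injectiveP h_inj | hNinj].
  rewrite (eq_bigr (fun=> -1)) ?prodr_const ?card_ord // => t _.
  by rewrite (injF_onto h_inj).
suff [t tNh] : exists t, t \notin codom h by rewrite (bigD1 t) //= (negPf tNh) mul0r.
apply/existsP; rewrite -negb_forall; apply: contra hNinj => /forallP h_onto.
have /image_injP h_inj : #|image h 'I_m| == #|'I_m|.
  by apply/eqP/eq_card => t; rewrite h_onto.
by apply/injectiveP => i j; apply: h_inj.
Qed.

(* Polarization with coefficients in {0, 1}, hence valid over every ring. *)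
Lemma mixed_permanent0 (R : comNzRingType) (m : nat) (B : 'I_m -> 'M[R]_m) :
  (forall e : 'I_m -> bool, permanent (\sum_t (e t)%:R *: B t) = 0) ->
  mixed_permanent B = 0.
Proof.
move=> per0.
have: \sum_(e : {ffun 'I_m -> bool})
        (\prod_t (-1) ^+ e t) * permanent (\sum_t (e t)%:R *: B t) = 0.
  by rewrite big1 // => e _; rewrite per0 mulr0.
suff -> : \sum_(e : {ffun 'I_m -> bool})
      (\prod_t (-1) ^+ e t) * permanent (\sum_t (e t)%:R *: B t) =
    (-1) ^+ m * mixed_permanent B.
  by move/(congr1 ( *%R ((-1) ^+ m))); rewrite mulrA -expr2 sqrr_sign mul1r mulr0.
rewrite /permanent; under eq_bigr do rewrite mulr_sumr.
rewrite exchange_big mulr_sumr; apply: eq_bigr => s _ /=.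
transitivity (\sum_(h : {ffun 'I_m -> 'I_m} | injectiveb h)
    (-1) ^+ m * \prod_i B (h i) i (s i)); last first.
  rewrite mulr_sumr (reindex (@pval _)) /=; last first.
    (* The default [1%g] is never reached on injective functions. *)
    exists (insubd (1%g : 'S_m)) => [/= u _ | u]; first by rewrite /insubd valK.
    by move=> hu; apply: insubdK.
  apply: eq_big => [u | u _]; first exact: (valP u).
  by rewrite pvalE.
transitivity (\sum_(e : {ffun 'I_m -> bool}) \sum_(h : {ffun 'I_m -> 'I_m})
    ((\prod_t (-1) ^+ e t) * \prod_i (e (h i))%:R) * \prod_i B (h i) i (s i)).
  apply: eq_bigr => e _.
  have -> : \prod_i (\sum_t (e t)%:R *: B t) i (s i) =
      \prod_i \sum_t (e t)%:R * B t i (s i).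
    by apply: eq_bigr => i _; rewrite summxE; apply: eq_bigr => t _; rewrite mxE.
  rewrite bigA_distr_bigA mulr_sumr; apply: eq_bigr => h _.
  by rewrite !big_split mulrA.
rewrite exchange_big [RHS]big_mkcond; apply: eq_bigr => h _ /=.
by rewrite -mulr_suml signed_subset_sum; case: ifP; rewrite ?mul0r.
Qed.

(** Injections instead of sorted subsets let the rows and columns be listed in any order. *)
Definition permanent_null (F : fieldType) (n m : nat) (W : {vspace 'M[F]_n}) :=
  forall A, A \in W -> forall f g : 'I_m -> 'I_n, injective f -> injective g ->
  permanent (mxsub f g A) = 0.

Lemma permanent_null_mixed (F : fieldType) (n m : nat) (W : {vspace 'M[F]_n})
    (B : 'I_m -> 'M[F]_n) (f g : 'I_m -> 'I_n) :
  permanent_null m W -> (forall t, B t \in W) -> injective f -> injective g ->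
  mixed_permanent (fun t => mxsub f g (B t)) = 0.
Proof.
move=> Wnull BW f_inj g_inj; apply: mixed_permanent0 => e.
rewrite -(Wnull (\sum_t (e t)%:R *: B t) _ f g) //; last first.
  by apply: memv_suml => t _; rewrite memvZ.
congr permanent; apply/matrixP => i j; rewrite !(mxE, summxE).
by apply: eq_bigr => t _; rewrite !mxE.
Qed.

(** * Coordinate subspaces and pivots *)

Definition cellspace (F : fieldType) (n : nat) (S : {set 'I_n * 'I_n}) :
    {vspace 'M[F]_n} :=
  <<[seq delta_mx p.1 p.2 | p in S]>>%VS.

Lemma delta_cellspace (F : fieldType) (n : nat) (S : {set 'I_n * 'I_n}) i j :
  (i, j) \in S -> delta_mx i j \in cellspace F S.
Proof. by move=> Sij; apply/memv_span/imageP; exists (i, j). Qed.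

Lemma memv_cellspace (F : fieldType) (n : nat) (S : {set 'I_n * 'I_n}) (A : 'M[F]_n) :
  A \in cellspace F S <-> forall i j, (i, j) \notin S -> A i j = 0.
Proof.
split=> [AS i j SNij | A0].
  have AX : A \in <<in_tuple [seq (delta_mx p.1 p.2 : 'M[F]_n) | p in S]>>%VS by [].
  rewrite (coord_span AX) summxE big1 // => l _; rewrite mxE.
  have /imageP [p pS ->] := mem_nth 0 (ltn_ord l).
  rewrite mxE; case: eqP => [iE | _]; last by rewrite mulr0.
  case: eqP => [jE | _]; last by rewrite mulr0.
  by case/negP: SNij; rewrite iE jE -surjective_pairing.
rewrite [A]matrix_sum_delta; apply: memv_suml => i _; apply: memv_suml => j _.
have [Sij | /A0 ->] := boolP ((i, j) \in S); last by rewrite scale0r mem0v.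
by rewrite memvZ ?delta_cellspace.
Qed.

Lemma dim_cellspace_le (F : fieldType) (n : nat) (S : {set 'I_n * 'I_n}) :
  (\dim (cellspace F S) <= #|S|)%N.
Proof. by apply: leq_trans (dim_span _) _; rewrite size_map -cardE. Qed.

Lemma cellspace_addC (F : fieldType) (n : nat) (S : {set 'I_n * 'I_n}) :
  (cellspace F S + cellspace F (~: S))%VS = fullv.
Proof.
apply/eqP; rewrite eqEsubv subvf; apply/subvP => A _.
rewrite [A]matrix_sum_delta; apply: memv_suml => i _; apply: memv_suml => j _.
apply: memvZ; have [Sij | SNij] := boolP ((i, j) \in S).
  by apply: (subvP (addvSl _ _)); apply: delta_cellspace.
by apply: (subvP (addvSr _ _)); apply: delta_cellspace; rewrite inE.
Qed.

(** The cell spaces of [S] and its complement have dimension at most their numbers of cells and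
    together span dimension [n * n], so both bounds are tight. *)
Lemma dim_cellspace (F : fieldType) (n : nat) (S : {set 'I_n * 'I_n}) :
  \dim (cellspace F S) = #|S|.
Proof.
apply/eqP; rewrite eqn_leq dim_cellspace_le /=.
have := dimv_add_leqif (cellspace F S) (cellspace F (~: S)).
rewrite cellspace_addC dimvf /dim /= => -[le_sum _].
rewrite -(leq_add2r #|~: S|) cardsC card_prod card_ord.
by apply: leq_trans le_sum _; rewrite leq_add2l dim_cellspace_le.
Qed.

(** Row-by-row position of a cell, which turns the lexicographic order into that of natural
    numbers. *)
Definition lexrank (n : nat) (p : 'I_n * 'I_n) : nat := (p.1 * n + p.2)%N.

Lemma lexrank_inj n : injective (@lexrank n).
Proof.
move=> [i j] [i' j'] /= eqw.
have n_gt0 : (0 < n)%N by apply: leq_ltn_trans (ltn_ord i).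
have := congr1 (divn^~ n) eqw; have := congr1 (modn^~ n) eqw.
rewrite /lexrank /= !modnMDl !modn_small // !divnMDl // !divn_small // !addn0.
by move=> /val_inj -> /val_inj ->.
Qed.

Lemma leq_lexrank1 n (p q : 'I_n * 'I_n) :
  (lexrank p <= lexrank q)%N -> (p.1 <= q.1)%N.
Proof.
have n_gt0 : (0 < n)%N by apply: leq_ltn_trans (ltn_ord p.1).
move/(leq_div2r n); rewrite /lexrank !divnMDl //.
by rewrite !divn_small // !addn0.
Qed.

Lemma leq_lexrank2 n (i j j' : 'I_n) :
  (lexrank (i, j) <= lexrank (i, j'))%N -> (j <= j')%N.
Proof. by rewrite /lexrank leq_add2l. Qed.

(* Phrased with subspaces rather than [exists A, A \in W /\ ...] so as to be a
   boolean predicate; see [pivotsP]. *)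
Definition pivots (F : fieldType) (n : nat) (W : {vspace 'M[F]_n}) :
    {set 'I_n * 'I_n} :=
  [set p | ~~ (W :&: cellspace F [set q | lexrank p <= lexrank q]%N
               <= cellspace F [set q | lexrank p < lexrank q]%N)%VS].

Lemma pivotsP (F : fieldType) (n : nat) (W : {vspace 'M[F]_n}) (i j : 'I_n) :
  (i, j) \in pivots W <->
  exists A, [/\ A \in W, A i j != 0 &
    forall i' j', A i' j' != 0 -> (lexrank (i, j) <= lexrank (i', j'))%N].
Proof.
rewrite inE; split.
  case/subvPn=> A; rewrite memv_cap => /andP [AW /memv_cellspace Age] Agt.
  exists A; split=> // [| i' j']; last first.
    by apply: contraNT => lt_w; apply/eqP/Age; rewrite inE.
  apply: contraNneq Agt => Aij0; apply/memv_cellspace => i' j'.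
  rewrite inE -leqNgt leq_eqVlt => /orP [/eqP/lexrank_inj [-> ->] // | lt_w].
  by apply: Age; rewrite inE -ltnNge.
case=> A [AW Aij0 Age]; apply/subvPn; exists A.
  rewrite memv_cap AW; apply/memv_cellspace => i' j'; rewrite inE.
  by apply: contraNeq => /Age.
by apply: contraNN Aij0 => /memv_cellspace ->; rewrite ?inE ?ltnn.
Qed.

(** The leading cell of a nonzero element of [W] is a pivot, so no such element vanishes on all
    pivots. *)
Lemma capv_pivotsC (F : fieldType) (n : nat) (W : {vspace 'M[F]_n}) :
  (W :&: cellspace F (~: pivots W) = 0)%VS.
Proof.
apply/eqP; rewrite -subv0; apply/subvP => A.
rewrite memv_cap memv0 => /andP [AW /memv_cellspace A0].
apply: contraT => An0.
have [p0 Ap0] : exists p, A p.1 p.2 != 0.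
  apply/existsP; apply: contraNT An0; rewrite negb_exists => /forallP Ap.
  by apply/eqP/matrixP => i j; have /negPn/eqP := Ap (i, j); rewrite mxE.
have [[i j] /= Aij Amin] :=
  @arg_minnP _ p0 (fun p => A p.1 p.2 != 0) (@lexrank n) Ap0.
case/eqP: (Aij); apply: A0; rewrite inE negbK; apply/pivotsP.
by exists A; split=> // i' j' Aij'; apply: (Amin (i', j')).
Qed.

Lemma dim_pivots_le (F : fieldType) (n : nat) (W : {vspace 'M[F]_n}) :
  (\dim W <= #|pivots W|)%N.
Proof.
rewrite -(leq_add2r #|~: pivots W|) -{1}(dim_cellspace F (~: _)) cardsC.
rewrite -(dimv_disjoint_sum (capv_pivotsC W)) card_prod card_ord.
by apply: leq_trans (dimvS (subvf _)) _; rewrite dimvf /dim.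
Qed.

(** Equality of dimensions makes [W] and the cell space off the pivots complementary; [B] is the
    component in [W] of [delta_mx i j]. *)
Lemma pivot_dual (F : fieldType) (n : nat) (W : {vspace 'M[F]_n}) :
  \dim W = #|pivots W| -> forall i j, exists2 B, B \in W &
    forall i' j', (i', j') \in pivots W -> B i' j' = ((i' == i) && (j' == j))%:R.
Proof.
move=> dimW i j.
have: delta_mx i j \in (W + cellspace F (~: pivots W))%VS.
  suff -> : (W + cellspace F (~: pivots W))%VS = fullv by rewrite memvf.
  apply/eqP; rewrite eqEdim subvf (dimv_disjoint_sum (capv_pivotsC W)).
  by rewrite dimW dim_cellspace cardsC card_prod card_ord dimvf /dim /=.
case/memv_addP=> B BW [C /memv_cellspace C0 deltaE]; exists B => // i' j' Sij.
have /matrixP/(_ i' j') := deltaE.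
by rewrite !mxE C0 ?addr0 // inE negbK.
Qed.

(** [f] and its composite with [s] have equal sums, so no inequality can be strict. *)
Lemma perm_contract1 (m : nat) (f : 'I_m -> nat) (s : 'S_m) :
  injective f -> (forall i, f (s i) <= f i)%N -> s = 1%g.
Proof.
move=> f_inj le_f.
have /leqif_sum [_] : forall i : 'I_m, true -> (f (s i) <= f i ?= iff (f (s i) == f i))%N.
  by move=> i _; split.
rewrite [X in (_ == X)%N](reindex_inj (@perm_inj _ s)) eqxx => /esym/forallP fE.
by apply/permP => i; rewrite perm1; apply: f_inj; apply/eqP; apply: fE.
Qed.

(* In the mixed permanent of matrices led by the cells of a matching, a
   nonzero term can only move cells forward in the lexicographic order; since
   rows and then columns are permuted, it is the identity term. *)
Lemma pivots_matching (F : fieldType) (n m : nat) (W : {vspace 'M[F]_n})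
    (f g : 'I_m -> 'I_n) :
  permanent_null m W -> injective f -> injective g ->
  ~ (forall a, (f a, g a) \in pivots W).
Proof.
move=> Wnull f_inj g_inj piv.
have B_ex a : exists A : 'M[F]_n, (A \in W) && (A (f a) (g a) != 0) &&
    [forall p, (A p.1 p.2 != 0) ==> (lexrank (f a, g a) <= lexrank p)%N].
  have /pivotsP [A [AW An0 Age]] := piv a; exists A; rewrite AW An0 /=.
  by apply/forallP => -[i j]; apply/implyP => /Age.
pose B a := xchoose (B_ex a).
have BP a : [/\ B a \in W, B a (f a) (g a) != 0 &
    forall i j, B a i j != 0 -> (lexrank (f a, g a) <= lexrank (i, j))%N].
  have /andP [/andP [BW Bn0] /forallP Bge] := xchooseP (B_ex a).
  by split=> // i j; have /implyP := Bge (i, j).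
have BW a : B a \in W by case: (BP a).
have := permanent_null_mixed Wnull BW f_inj g_inj.
rewrite /mixed_permanent pair_big (bigD1 (1%g, 1%g)) //= [X in _ + X]big1 => [|[s t] /= st1].
  rewrite /= addr0; apply/eqP/prodf_neq0 => a _; rewrite mxE !perm1.
  by case: (BP a).
apply/eqP; apply: contraNT st1 => /prodf_neq0 Bn0.
have le_w a : (lexrank (f (t a), g (t a)) <= lexrank (f a, g (s a)))%N.
  by case: (BP (t a)) => _ _; apply; have := Bn0 a isT; rewrite mxE.
have t1 : t = 1%g.
  apply: (@perm_contract1 _ (fun a => f a)) => [a b /val_inj/f_inj // | a].
  by have /leq_lexrank1 := le_w a.
(* With [t] trivial, the two compared cells share a row, so their columns can be compared. *)
have s1 : s^-1%g = 1%g.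
  apply: (@perm_contract1 _ (fun a => g a)) => [a b /val_inj/g_inj // | a].
  by have := le_w ((s^-1)%g a); rewrite t1 !perm1 permKV => /leq_lexrank2.
by rewrite t1 -(invgK s) s1 invg1.
Qed.

(** * Cell sets meeting every permutation in at most k cells *)

Lemma perm_two_points (T : finType) (x x' y y' : T) :
  x != x' -> y != y' -> exists s : {perm T}, s x = y /\ s x' = y'.
Proof.
(* The first transposition sends [x] to [y]; the second carries the image of [x'] to [y'] and fixes
   [y]. *)
move=> xx' yy'; exists (tperm x y * tperm (tperm x y x') y')%g.
rewrite !permM tpermL tpermL; split=> //; rewrite tpermD //; last by rewrite eq_sym.
by rewrite -{2}(tpermL x y) (inj_eq perm_inj) eq_sym.
Qed.

(** A cell [(i, j)] lies on exactly one shift of [s], the one with [c = j - s i] in the cyclic group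
    of indices. *)
Lemma sum_cyclic_shifts (n : nat) (S : {set 'I_n.+1 * 'I_n.+1}) (s : 'S_n.+1) :
  (\sum_(c < n.+1) #|[set i | (i, s i + c)%R \in S]| = #|S|)%N.
Proof.
transitivity (\sum_(i < n.+1) \sum_(j < n.+1) ((i, j) \in S))%N; last first.
  rewrite pair_bigA -sum1_card [RHS]big_mkcond; apply: eq_bigr => -[i j] _ /=.
  by case: (_ \in S).
under eq_bigr do rewrite -sum1_card big_mkcond /=.
rewrite exchange_big /=; apply: eq_bigr => i _.
rewrite [RHS](reindex_inj (addrI (s i))) /=.
by apply: eq_bigr => c _; rewrite inE; case: (_ \in S).
Qed.

Lemma eq_leq_sum_const (n k : nat) (a : 'I_n -> nat) :
  (forall c, a c <= k)%N -> (k * n <= \sum_c a c)%N ->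
  (\sum_c a c = k * n)%N /\ forall c, a c = k.
Proof.
move=> le_a.
have /leqif_sum [le_sum eq_sum] : forall c : 'I_n, true -> (a c <= k ?= iff (a c == k))%N.
  by move=> c _; split.
move: le_sum eq_sum; rewrite sum_nat_const card_ord mulnC => le_sum eq_sum ge_sum.
have sumE : \sum_c a c = (k * n)%N by apply/eqP; rewrite eqn_leq le_sum.
split=> // c; apply/eqP; move: c; apply/forallP.
by rewrite -eq_sum sumE.
Qed.


Section FullCellSets.

Variables (n' k : nat).
Let n := n'.+1.
Variable S : {set 'I_n * 'I_n}.
Hypothesis S_le : forall s : 'S_n, (#|[set i | (i, s i) \in S]| <= k)%N.
Hypothesis S_ge : (k * n <= #|S|)%N.

(** The [n] shifts of [s] meet [S] in at most [k] cells each and at least [k * n] in all, so every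
    bound is attained; the shift by 0 is [s] itself. *)
Lemma full_cells_perm (s : 'S_n) :
  #|S| = (k * n)%N /\ #|[set i | (i, s i) \in S]| = k.
Proof.
have shift_inj c : injective (fun i => s i + c) by move=> i j /addIr/perm_inj.
have le_k c : (#|[set i | (i, s i + c)%R \in S]| <= k)%N.
  apply: leq_trans (S_le (perm (shift_inj c))).
  by rewrite leq_eqVlt; apply/orP; left; apply/eqP/eq_card => i; rewrite !inE permE.
have [] := eq_leq_sum_const le_k; rewrite sum_cyclic_shifts // => cS /(_ 0) eq_k.
split=> //; rewrite -[RHS]eq_k; apply: eq_card => i.
by rewrite !inE addr0.
Qed.

(** Two permutations that differ by exchanging their values at [i] and [i'] both meet [S] in [k]
    cells, and their common cells cancel. *)
Lemma full_cells_exchange i i' j j' :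
  (((i, j) \in S) + ((i', j') \in S) = ((i, j') \in S) + ((i', j) \in S))%N.
Proof.
have [-> | ii'] := eqVneq i i'; first by rewrite addnC.
have [-> // | jj'] := eqVneq j j'.
have cardE (s : 'S_n) :
    (k = ((i, s i) \in S) + (((i', s i') \in S)
          + \sum_(l | (l != i) && (l != i')) ((l, s l) \in S)))%N.
  have [_ <-] := full_cells_perm s; rewrite -sum1_card big_mkcond /=.
  rewrite (bigD1 i) //= (bigD1 i') 1?eq_sym //= !inE.
  congr (_ + (_ + _))%N; try by case: ifP.
  by apply: eq_bigr => l _; rewrite inE; case: ifP.
have [s [si si']] := perm_two_points ii' jj'.
have := cardE s; rewrite [LHS](cardE (tperm i i' * s)%g).
rewrite !permM tpermL tpermR si si' !addnA.
rewrite (eq_bigr (fun l => ((l, s l) \in S) : nat)) => [/addIn -> // | l].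
by case/andP=> li li'; rewrite permM tpermD // eq_sym.
Qed.

Lemma full_cells_lines : exists2 I : {set 'I_n}, #|I| = k &
  S = setX I setT \/ S = setX setT I.
Proof.
have [cS _] := full_cells_perm 1%g.
have [/forallP row | /forallPn [i /forallPn [j /forallPn [j' Sij]]]] :=
  boolP [forall i, forall j, forall j', ((i, j) \in S) == ((i, j') \in S)].
  pose I := [set i | (i, ord0) \in S]; have SE : S = setX I setT.
    apply/setP => -[i j]; rewrite !inE andbT.
    by have /forallP/(_ j)/forallP/(_ ord0)/eqP := row i.
  exists I; last by left.
  by move: cS; rewrite SE cardsX cardsT card_ord => /eqP; rewrite eqn_pmul2r // => /eqP.
(* Row [i] separates [j] from [j']. By exchange, row [i'] has the same difference of 1 or -1 there,
   which determines its value at [j]; exchange with [j] then gives every other column. *)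
have col i' l : ((i', l) \in S) = ((i, l) \in S).
  have eq_j : ((i', j) \in S) = ((i, j) \in S).
    have := full_cells_exchange i i' j j'; move: Sij.
    by do 4!case: (_ \in S).
  have := full_cells_exchange i i' j l; rewrite eq_j.
  by do 3!case: (_ \in S).
pose I := [set l | (i, l) \in S]; have SE : S = setX setT I.
  by apply/setP => -[i' l]; rewrite !inE /= col.
exists I; last by right.
by move: cS; rewrite SE cardsX cardsT card_ord mulnC => /eqP; rewrite eqn_pmul2r // => /eqP.
Qed.

End FullCellSets.

Lemma pivots_perm_le (F : fieldType) (n k : nat) (W : {vspace 'M[F]_n}) (s : 'S_n) :
  permanent_null k.+1 W -> (#|[set i | (i, s i) \in pivots W]| <= k)%N.
Proof.
move=> Wnull; rewrite leqNgt; apply/negP => lt_k.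
pose f (a : 'I_k.+1) := enum_val (widen_ord lt_k a).
have f_inj : injective f.
  by move=> a b /enum_val_inj/(congr1 val) /= /val_inj.
apply: (pivots_matching Wnull f_inj (g := s \o f)); first exact: inj_comp perm_inj f_inj.
by move=> a; have := enum_valP (widen_ord lt_k a); rewrite inE.
Qed.

(** * Rigidity *)

(* With [B i j] the element of W that restricts to the cell (i, j) on the rows
   in I, only two terms of the mixed permanent on the rows I + r survive: the
   identity, and the one exchanging the two cells of row i. *)
Lemma dual_rows_relation (F : fieldType) (n : nat) (W : {vspace 'M[F]_n})
    (I : {set 'I_n}) (B : 'I_n -> 'I_n -> 'M[F]_n) :
  permanent_null #|I|.+1 W -> (forall i j, B i j \in W) ->
  (forall i j i' j', i' \in I -> B i j i' j' = ((i' == i) && (j' == j))%:R) ->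
  forall i j j1 r c, i \in I -> r \notin I -> j != j1 -> c != j1 ->
  B i j r c + (c == j)%:R * B i j1 r j1 = 0.
Proof.
move=> Wnull BW BI i j j1 r c iI rI jj1 cj1.
(* Index 0 stands for the extra row [r]; the other indices enumerate [I]. *)
pose f (a : 'I_#|I|.+1) := oapp enum_val r (unlift ord0 a).
have f0 : f ord0 = r by rewrite /f unlift_none.
have fI a : a != ord0 -> f a \in I.
  rewrite eq_sym /f => /unlift_some [b _ ->]; exact: enum_valP.
have f_inj : injective f.
  move=> a b; rewrite /f; case: unliftP => [a' ->|->]; case: unliftP => [b' ->|->] //=.
  - by move/enum_val_inj ->.
  - by move=> e; case/negP: rI; rewrite -e enum_valP.
  - by move=> e; case/negP: rI; rewrite e enum_valP.
pose l1 := lift ord0 (enum_rank_in iI i).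
have l1n0 : l1 != ord0 by rewrite eq_sym neq_lift.
have fl1 : f l1 = i by rewrite /f liftK /= enum_rankK_in.
have lt_In : (#|I| < n)%N.
  rewrite -[X in (_ < X)%N]card_ord -cardsT proper_card // properT.
  by apply: contraNneq rI => ->; rewrite inE.
have [g [g_inj g0 gl1]] : exists g : 'I_#|I|.+1 -> 'I_n,
    [/\ injective g, g ord0 = c & g l1 = j1].
  have w_inj : injective (widen_ord lt_In) by move=> a b /(congr1 val) /= /val_inj.
  have w01 : widen_ord lt_In ord0 != widen_ord lt_In l1 by rewrite (inj_eq w_inj) eq_sym.
  have [s [s0 s1]] := perm_two_points w01 cj1.
  by exists (s \o widen_ord lt_In); split=> //; apply: inj_comp perm_inj w_inj.
(* Index 0 gets [B i j]; every other index gets the element dual to its own diagonal cell. *)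
pose C a := if a == ord0 then B i j else B (f a) (g a).
have CW a : C a \in W by rewrite /C; case: ifP.
have C0 : C ord0 = B i j by rewrite /C eqxx.
have CE a : a != ord0 -> C a = B (f a) (g a) by rewrite /C => /negPf ->.
have CI a b b' : b != ord0 -> a != ord0 -> C a (f b) (g b') = ((b == a) && (b' == a))%:R.
  by move=> bn0 an0; rewrite CE // BI ?fI // !inj_eq.
pose u := tperm ord0 l1.
have := permanent_null_mixed Wnull CW f_inj g_inj.
have u1 : u != 1%g.
  by apply: contra_neq l1n0 => u1; rewrite -(tpermL ord0 l1) -/u u1 perm1.
rewrite /mixed_permanent pair_big (bigD1 (1%g, 1%g)) //= (bigD1 (u, u)) /=; last first.
  by apply: contraNneq u1 => -[-> _].
(* The identity pair contributes [B i j r c]; the pair [(u, u)] contributes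
   [B i j i c * B i j1 r j1], whose first factor is [(c == j)%:R]. *)
rewrite [X in _ + (_ + X)]big1 ?addr0 => [|[s t] /= /andP [st1 stu]].
  move=> rel; rewrite -[RHS]rel; congr (_ + _).
    rewrite (bigD1 ord0) //= big1 ?mulr1 ?mxE ?perm1 ?C0 ?f0 ?g0 // => a an0.
    by rewrite mxE !perm1 CI // eqxx.
  rewrite (bigD1 ord0) //= (bigD1 l1) //= [X in _ * (_ * X)]big1 => [|a /andP [an0 al1]].
    rewrite !mxE tpermL tpermR CE // C0 fl1 gl1 g0 f0.
    by rewrite [B i j i c]BI // eqxx mulr1 mulrC.
  by rewrite mxE /u tpermD 1?eq_sym // CI // eqxx.
apply/eqP; apply: contraTT isT => /prodf_neq0 term_n0.
have term a : C (t a) (f a) (g (s a)) != 0 by have := term_n0 a isT; rewrite mxE.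
(* On the rows of [I], a matrix of nonzero index has a single nonzero cell, its diagonal one. *)
have fix_st a : a != ord0 -> t a != ord0 -> t a = a /\ s a = a.
  move=> an0 tan0; have := term a; rewrite CI //.
  case: (a =P t a) => [<- | _] /=; last by rewrite eqxx.
  by case: (s a =P a) => // _; rewrite eqxx.
(* If [B i j] supplies row [r], every other index is fixed, which leaves the identity pair. *)
have [t0 | tn0] := eqVneq (t ord0) ord0.
  have tN a : a != ord0 -> t a != ord0.
    by apply: contra_neq => ta0; apply: (@perm_inj _ t); rewrite ta0 t0.
  have t1 : t = 1%g.
    apply/permP => a; rewrite perm1; have [-> // | an0] := eqVneq a ord0.
    by case: (fix_st a an0 (tN a an0)).
  case/eqP: st1; rewrite t1; congr pair; apply/permP => a; rewrite perm1.
  have sN b : b != ord0 -> s b = b by move=> bn0; case: (fix_st b bn0 (tN b bn0)).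
  have [-> | an0] := eqVneq a ord0; last exact: sN.
  by apply/eqP; apply: contraT => s0; have /perm_inj s00 := sN _ s0; rewrite s00 eqxx in s0.
(* Otherwise [B i j] supplies a row of [I], necessarily row [i], of index [l1]; then [s] and [t]
   both equal [u]. *)
pose b := (t^-1)%g ord0.
have tb : t b = ord0 by rewrite /b permKV.
have bn0 : b != ord0 by apply: contra_neq tn0 => b0; rewrite -{1}b0.
have := term b; rewrite tb C0 BI ?fI //.
case: (f b =P i) => [fb | _] /=; last by rewrite eqxx.
have bl1 : b = l1 by apply: f_inj; rewrite fb fl1.
case: (g (s b) =P j) => [gsb _ | _]; last by rewrite eqxx.
have fixE a : a != ord0 -> a != l1 -> t a = a /\ s a = a.
  move=> an0 al1; apply: fix_st => //; apply: contra_neq al1 => ta0.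
  by rewrite -bl1; apply: (@perm_inj _ t); rewrite tb.
have s_l1 : s l1 = ord0.
  apply/eqP; apply: contraT => sl1n0.
  have sl1 : s l1 != l1 by apply: contra_neq jj1 => sl1; rewrite -gsb bl1 sl1.
  by have [_ /perm_inj e] := fixE _ sl1n0 sl1; rewrite e eqxx in sl1.
have t_l1 : t l1 = ord0 by rewrite -bl1.
have swap (v : 'S_#|I|.+1) : v l1 = ord0 ->
    (forall a, a != ord0 -> a != l1 -> v a = a) -> v = u.
  move=> vl1 vN; apply/permP => a; rewrite /u; case: tpermP => [-> | -> // | ].
    have [// | vn1] := eqVneq (v ord0) l1.
    have [v0 | vn0] := eqVneq (v ord0) ord0.
      by case/eqP: l1n0; apply: (@perm_inj _ v); rewrite vl1 v0.
    by have /perm_inj e := vN _ vn0 vn1; rewrite e eqxx in vn0.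
  by move=> /eqP an0 /eqP al1; apply: vN.
by case/eqP: stu; congr pair; apply: swap => // a an0 al1; case: (fixE a an0 al1).
Qed.

Lemma ord_avoid2 (n : nat) (x y : 'I_n) : (2 < n)%N -> exists z : 'I_n, x != z /\ y != z.
Proof.
move=> n_gt2; have /card_gt0P [z] : (0 < #|~: [set x; y]|)%N.
  rewrite -(ltn_add2l #|[set x; y]|) cardsC addn0 card_ord cards2.
  by apply: leq_ltn_trans n_gt2; case: (_ != _).
by rewrite !inE negb_or => /andP [zx zy]; exists z; rewrite ![_ == z]eq_sym.
Qed.

Lemma dual_rows_delta (F : fieldType) (n : nat) (W : {vspace 'M[F]_n})
    (I : {set 'I_n}) :
  2%N \notin [pchar F] -> (2 < n)%N -> permanent_null #|I|.+1 W ->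
  (forall i j, exists2 A, A \in W &
     forall i' j', i' \in I -> A i' j' = ((i' == i) && (j' == j))%:R) ->
  forall i j, i \in I -> delta_mx i j \in W.
Proof.
move=> char2 n_gt2 Wnull W_dual i j iI.
have B_ex a b : exists A : 'M[F]_n, (A \in W) &&
    [forall p, (p.1 \in I) ==> (A p.1 p.2 == ((p.1 == a) && (p.2 == b))%:R)].
  have [A AW AE] := W_dual a b; exists A; rewrite AW.
  by apply/forallP => p; apply/implyP => pI; rewrite AE.
pose B a b := xchoose (B_ex a b).
have BW a b : B a b \in W by have /andP [] := xchooseP (B_ex a b).
have BI a b a' b' : a' \in I -> B a b a' b' = ((a' == a) && (b' == b))%:R.
  have /andP [_ /forallP/(_ (a', b'))/implyP H] := xchooseP (B_ex a b).
  by move=> /H /eqP.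
have rel := dual_rows_relation Wnull BW BI.
have two_n0 : 2%:R != 0 :> F by move: char2; rewrite inE /=.
suff B0 r c : r \notin I -> B i j r c = 0.
  suff -> : delta_mx i j = B i j by [].
  apply/matrixP => r c; rewrite mxE.
  have [rI | rI] := boolP (r \in I); first by rewrite BI.
  by rewrite B0 // (negPf (memPnC rI i iI)).
move=> rI; have [-> | cj] := eqVneq c j; last first.
  have [j1 [jj1 cj1]] := ord_avoid2 j c n_gt2.
  by have := rel i j j1 r c iI rI jj1 cj1; rewrite (negPf cj) mul0r addr0.
(* For distinct columns [j], [j1], [j2], the entries of [B i j], [B i j1], [B i j2] in row [r] and
   their own columns have zero pairwise sums. *)
have [j1 [jj1 _]] := ord_avoid2 j j n_gt2.
have [j2 [jj2 j12]] := ord_avoid2 j j1 n_gt2.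
have r1 := rel i j j1 r j iI rI jj1 jj1.
have r2 := rel i j j2 r j iI rI jj2 jj2.
have r3 := rel i j1 j2 r j1 iI rI j12 j12.
move: r1 r2 r3; rewrite !eqxx !mul1r.
set x := B i j r j; set y := B i j1 r j1; set z := B i j2 r j2 => r1 r2 r3.
have : 2%:R * x = 0.
  have yE : y = - x by apply/eqP; rewrite -addr_eq0 addrC r1.
  have zE : z = - x by apply/eqP; rewrite -addr_eq0 addrC r2.
  by apply/eqP; rewrite mulr_natl mulr2n -oppr_eq0 opprD -{1}yE -zE r3.
by move/eqP; rewrite mulf_eq0 (negPf two_n0) => /eqP.
Qed.

(** Reduces to rows by transposition, taken as a linear map so that the image of [W] is a
    subspace. *)
Lemma dual_cols_delta (F : fieldType) (n : nat) (W : {vspace 'M[F]_n})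
    (I : {set 'I_n}) :
  2%N \notin [pchar F] -> (2 < n)%N -> permanent_null #|I|.+1 W ->
  (forall i j, exists2 A, A \in W &
     forall i' j', j' \in I -> A i' j' = ((i' == i) && (j' == j))%:R) ->
  forall i j, j \in I -> delta_mx i j \in W.
Proof.
move=> char2 n_gt2 Wnull W_dual i j jI.
pose tr : 'End('M[F]_n) := linfun trmx.
have trE A : tr A = A^T by rewrite lfunE.
have : delta_mx j i \in (tr @: W)%VS.
  apply: (dual_rows_delta (I := I)) => // [B | a b].
    case/memv_imgP=> A AW -> f g f_inj g_inj.
    by rewrite trE -trmx_mxsub permanent_trmx Wnull.
  have [A AW AE] := W_dual b a; exists (tr A); first exact: memv_img.
  by move=> a' b' aI; rewrite trE mxE AE // andbC.
case/memv_imgP=> A AW /(congr1 trmx).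
by rewrite trE trmxK trmx_delta => ->.
Qed.

(** * Tensor products with coordinate subspaces *)

Lemma coord_space_eq0 (F : fieldType) (n : nat) (I : {set 'I_n}) (u : 'cV[F]_n) i :
  u \in coord_space F I -> i \notin I -> u i ord0 = 0.
Proof.
move=> uI iNI.
have uX : u \in <<in_tuple [seq (delta_mx i ord0 : 'cV[F]_n) | i in I]>>%VS by [].
rewrite (coord_span uX) summxE big1 // => l _; rewrite mxE.
have /imageP [i' iI ->] := mem_nth 0 (ltn_ord l).
by rewrite mxE (negPf (memPnC iNI i' iI)) mulr0.
Qed.

Lemma delta_coord_space (F : fieldType) (n : nat) (I : {set 'I_n}) i :
  i \in I -> delta_mx i ord0 \in coord_space F I.
Proof. by move=> iI; apply/memv_span/imageP; exists i. Qed.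

Lemma tensor_delta (F : fieldType) (n : nat) (i j : 'I_n) :
  tensor (delta_mx i ord0) (delta_mx j ord0) = delta_mx i j :> 'M[F]_n.
Proof. by rewrite /tensor trmx_delta mul_delta_mx. Qed.

Lemma tensorE (F : fieldType) (n : nat) (u v : 'cV[F]_n) i j :
  tensor u v i j = u i ord0 * v j ord0.
Proof. by rewrite !mxE big_ord1 !mxE. Qed.

Lemma tensorv_coord_fullv (F : fieldType) (n : nat) (I : {set 'I_n}) :
  tensorv (coord_space F I) fullv = cellspace F (setX I setT).
Proof.
apply/eqP; rewrite eqEsubv; apply/andP; split; apply/span_subvP => A.
  case/allpairsP=> -[u v] /= [/vbasis_mem uI _ ->]; apply/memv_cellspace => i j.
  by rewrite !inE andbT tensorE => /(coord_space_eq0 uI) ->; rewrite mul0r.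
case/imageP=> -[i j]; rewrite !inE andbT /= => iI ->.
by rewrite -tensor_delta memv_tensor ?memvf ?delta_coord_space.
Qed.

Lemma tensorv_fullv_coord (F : fieldType) (n : nat) (I : {set 'I_n}) :
  tensorv fullv (coord_space F I) = cellspace F (setX setT I).
Proof.
apply/eqP; rewrite eqEsubv; apply/andP; split; apply/span_subvP => A.
  case/allpairsP=> -[u v] /= [_ /vbasis_mem vI ->]; apply/memv_cellspace => i j.
  by rewrite !inE /= tensorE => /(coord_space_eq0 vI) ->; rewrite mulr0.
case/imageP=> -[i j]; rewrite !inE /= => jI ->.
by rewrite -tensor_delta memv_tensor ?memvf ?delta_coord_space.
Qed.

(** * Permanental rank of spaces of full rows or columns, and the characterization *)

Lemma permanental_rank_rows (R : comNzRingType) (n : nat) (I : {set 'I_n}) (A : 'M[R]_n) :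
  (forall i j, i \notin I -> A i j = 0) -> (permanental_rank A <= #|I|)%N.
Proof.
move=> A0; have [/existsP [J /existsP [K per_n0]] _] := permanental_rank_max A.
set m := permanental_rank A in J K per_n0 *.
rewrite -(eqP (valP J)); apply: subset_leq_card; apply/subsetP => i iJ.
(* A row outside [I] is zero and kills every product, so a nonzero minor uses only rows of [I]. *)
apply: contraNT per_n0 => iI; rewrite /permanent big1 // => s _.
pose a : 'I_m := cast_ord (eqP (valP J)) (enum_rank_in iJ i).
have aE : ksubset_elt J a = i by rewrite /ksubset_elt /a cast_ordK enum_rankK_in.
by rewrite (bigD1 a) //= mxE aE A0 // mul0r.
Qed.

Lemma rho1_cellspace_rows (F : fieldType) (n : nat) (I : {set 'I_n}) :
  rho1 (cellspace F (setX I setT)) #|I|.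
Proof.
have le_I (A : 'M[F]_n) : A \in cellspace F (setX I setT) -> (permanental_rank A <= #|I|)%N.
  move/memv_cellspace=> A0; apply: permanental_rank_rows => i j iI.
  by apply: A0; rewrite !inE andbT.
(* The bound is attained by the diagonal projection onto the coordinates in [I]: its minor on [I] is
   the identity. *)
split=> //; pose A : 'M[F]_n := \matrix_(i, j) ((i == j) && (i \in I))%:R.
have AI : A \in cellspace F (setX I setT).
  by apply/memv_cellspace => i j; rewrite !inE andbT mxE => /negPf ->; rewrite andbF.
exists A => //; apply/eqP; rewrite eqn_leq le_I //=.
apply: (proj2 (permanental_rank_max A)).
pose K : ksubset n #|I| := exist _ I (eqxx _).
have K_inj : injective (ksubset_elt K) by move=> a b /enum_val_inj/cast_ord_inj.
apply/existsP; exists K; apply/existsP; exists K.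
have -> : minormx A K K = 1%:M.
  apply/matrixP => a b; rewrite !mxE (inj_eq K_inj).
  by rewrite (ksubset_elt_mem K) andbT.
rewrite /permanent (bigD1 1%g) //= [X in _ + X]big1 ?addr0 => [|s s1].
  by rewrite big1 ?oner_neq0 // => a _; rewrite mxE perm1 eqxx.
apply/eqP; apply: contraNT s1 => /prodf_neq0 s_n0; apply/eqP/permP => a.
have := s_n0 a isT; rewrite mxE perm1.
by case: (a =P s a) => [// | _]; rewrite eqxx.
Qed.

Lemma rho1_cellspace_cols (F : fieldType) (n : nat) (I : {set 'I_n}) :
  rho1 (cellspace F (setX setT I)) #|I|.
Proof.
have trP (A : 'M[F]_n) (S T : {set 'I_n}) :
    A \in cellspace F (setX S T) -> A^T \in cellspace F (setX T S).
  move/memv_cellspace=> A0; apply/memv_cellspace => i j; rewrite !inE mxE andbC => Sij.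
  by apply: A0; rewrite !inE.
have [[A AI rA] le_I] := rho1_cellspace_rows F I.
split=> [|B BI]; first by exists A^T; [exact: trP | rewrite permanental_rank_trmx].
by rewrite -permanental_rank_trmx le_I // trP.
Qed.

Theorem theorem1p7 (F : fieldType) (charF : 2%N \notin [pchar F])
    (k n : nat) (le_kn : (k <= n)%N) (n_ge3 : (3 <= n)%N)
    (W : {vspace 'M[F]_n}) :
  (rho1 W k /\ (\dim W = k * n)%N) <->
  (exists2 I : {set 'I_n}, #|I| = k &
     W = tensorv (coord_space F I) fullv \/
     W = tensorv fullv (coord_space F I)).
Proof.
split=> [[[_ rk_le] dimW] | [I <- [->|->]]]; last first.
- rewrite tensorv_fullv_coord dim_cellspace cardsX cardsT card_ord mulnC.
  by split; first exact: rho1_cellspace_cols.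
- rewrite tensorv_coord_fullv dim_cellspace cardsX cardsT card_ord.
  by split; first exact: rho1_cellspace_rows.
(* The successor form gives ['I_n] the modular addition used by the cyclic shifts. *)
case: n le_kn n_ge3 W rk_le dimW => // n le_kn n_ge3 W rk_le dimW.
have Wnull : permanent_null k.+1 W.
  move=> A AW f g f_inj g_inj.
  by apply: permanental_rank_permanent0 => //; apply: rk_le.
have piv_le s := pivots_perm_le s Wnull.
have piv_ge : (k * n.+1 <= #|pivots W|)%N by rewrite -dimW dim_pivots_le.
have [card_piv _] := full_cells_perm piv_le piv_ge 1%g.
have dual := pivot_dual (etrans dimW (esym card_piv)).
have [I cI pivE] := full_cells_lines piv_le piv_ge.
(* Since [dim W] is the number of pivots, containing the unit matrices of these cells forces
   equality. *)
have cellE (S : {set 'I_n.+1 * 'I_n.+1}) : pivots W = S ->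
    (forall i j, (i, j) \in S -> delta_mx i j \in W) -> W = cellspace F S.
  move=> pivS deltaW; apply/esym/eqP; rewrite eqEdim dim_cellspace dimW -card_piv pivS.
  rewrite leqnn andbT; apply/span_subvP => A /imageP [[i j] Sij ->].
  exact: deltaW.
exists I => //; rewrite -cI in Wnull; case: pivE => pivE; [left | right].
  rewrite tensorv_coord_fullv; apply: cellE => // i j; rewrite !inE andbT.
  apply: dual_rows_delta => // a b; have [B BW BE] := dual a b; exists B => // a' b' aI.
  by apply: BE; rewrite pivE !inE aI.
rewrite tensorv_fullv_coord; apply: cellE => // i j; rewrite !inE /=.
apply: dual_cols_delta => // a b; have [B BW BE] := dual a b; exists B => // a' b' bI.
by apply: BE; rewrite pivE !inE bI.
Qed.
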